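(* Let $\mathcal{A}$ be a Banach algebra and let $\mathcal{A}^{**}$ be its second dual with the first Arens product $\Box$. (i) Suppose that $(\mathcal{A}^{**},\Box)$ is approximately amenable. Then $\mathcal{A}$ is approximately amenable. (ii) Suppose that $B(\mathcal{A},\mathcal{A}^* )=W(\mathcal{A},\mathcal{A}^* )$ and that $(\mathcal{A}^{**},\Box)$ is approximately weakly amenable. Then $\mathcal{A}$ is approximately weakly amenable.
   Context: For a Banach algebra $\mathcal{C}$, ''$\mathcal{C}$-module'' means Banach $\mathcal{C}$-bimodule. The dual $\mathcal{X}^*$ of a $\mathcal{C}$-module $\mathcal{X}$ is a $\mathcal{C}$-module via $\langle x, a\cdot\Lambda\rangle=\langle x\cdot a,\Lambda\rangle$ and $\langle x,\Lambda\cdot a\rangle=\langle a\cdot x,\Lambda\rangle$ for $a\in\mathcal{C}$, $x\in\mathcal{X}$, $\Lambda\in\mathcal{X}^*$. In particular $\mathcal{C}^*$ is the dual module of $\mathcal{C}$ regarded as a bimodule over itself. A derivation $D:\mathcal{C}\to\mathcal{X}$ is a linear map with $D(ab)=a\cdot D(b)+D(a)\cdot b$ for all $a,b\in\mathcal{C}$. It is approximately inner if there is a net $(x_\alpha)\subseteq\mathcal{X}$ (not required to be bounded) such that $D(a)=\lim_\alpha(a\cdot x_\alpha-x_\alpha\cdot a)$ in norm for every $a\in\mathcal{C}$. $\mathcal{C}$ is approximately amenable if for each $\mathcal{C}$-module $\mathcal{X}$ every bounded derivation $D:\mathcal{C}\to\mathcal{X}^*$ is approximately inner. $\mathcal{C}$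 is approximately weakly amenable if every bounded derivation $D:\mathcal{C}\to\mathcal{C}^*$ is approximately inner. First Arens product on $\mathcal{A}^{**}$: for $a,b\in\mathcal{A}$, $f\in\mathcal{A}^*$, $m,n\in\mathcal{A}^{**}$, $\langle f\Box a,b\rangle=\langle f,ab\rangle$, $\langle m\Box f,a\rangle=\langle m,f\Box a\rangle$, $\langle m\Box n,f\rangle=\langle m,n\Box f\rangle$. With it $\mathcal{A}^{**}$ is a Banach algebra. When approximate weak amenability of $\mathcal{A}^{**}$ is considered, $\mathcal{A}^{***}$ carries the $\mathcal{A}^{**}$-module structure dual to that of $\mathcal{A}^{**}$ as a bimodule over itself. $B(\mathcal{A},\mathcal{A}^* )$ is the space of bounded linear operators $\mathcal{A}\to\mathcal{A}^*$, and $W(\mathcal{A},\mathcal{A}^* )$ is the space of weakly compact ones. *)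

(* Defs.v *)
From HB Require Import structures.
From mathcomp Require Import all_boot all_order all_algebra.
From mathcomp Require Import complex.
From mathcomp Require Import boolp classical_sets functions reals.
From mathcomp Require Import topology normedtype.

Set Implicit Arguments.
Unset Strict Implicit.
Unset Printing Implicit Defensive.

Import Order.TTheory GRing.Theory Num.Theory.
Import numFieldNormedType.Exports.

Local Open Scope classical_set_scope.
Local Open Scope ring_scope.
Local Open Scope complex_scope.

(* Scalars are complex: Banach spaces are complete normed modules over R[i] for
   R : realType, so norms take (nonnegative real) values in R[i]. *)
#[warning="-redundant-canonical-projection"]
HB.instance Definition _ (R : realType) := NormedModule.copy R[i] R[i]^o.

Section ComplexComplete.
Variable R : realType.
Implicit Types (z : R[i]).

Lemma ger0_ReE z : 0 <= z -> z = (complex.Re z)%:C.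
Proof. by move=> z0; rewrite RRe_real// ger0_real. Qed.

Lemma normc_le_ReIm z : `|z| <= (`|complex.Re z| + `|complex.Im z|)%:C.
Proof.
case: z => a b /=.
have -> : a +i* b = a%:C + 'i * b%:C by simpc.
rewrite (le_trans (ler_normD _ _))// normrM.
have -> : `|'i : R[i]| = 1 by rewrite normc_def/= expr0n expr1n add0r sqrtr1.
by rewrite mul1r !normc_def/= !expr0n !addr0 !sqrtr_sqr rmorphD.
Qed.

Lemma normc_ge_Im z : `|complex.Im z|%:C <= `|z|.
Proof.
case: z => a b; rewrite normc_def/= lecR -sqrtr_sqr ler_wsqrtr//.
by rewrite lerDr sqr_ge0.
Qed.

Lemma complex_complete (F : set_system R[i]) :
  ProperFilter F -> cauchy F -> cvg F.
Proof.
move=> FF /cauchy_ballP Fc.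
have cvgp (p : R[i] -> R) : (forall z w, p (z - w) = p z - p w) ->
    (forall z, `|p z|%:C <= `|z|) -> cvg (p @ F).
  move=> pB pn; apply: R_complete; apply/cauchy_ballP => e e0.
  have e0' : (0 : R[i]) < e%:C by rewrite ltcR.
  case: (Fc _ e0') => -[A B] [/= FA FB] AB.
  exists (p @` A, p @` B).
    by split; [apply: filterS FA|apply: filterS FB] => z Az; exists z.
  case=> _ _ [/= [z Az <-] [w Bw <-]]; have := AB (z, w) (conj Az Bw).
  rewrite /= -!ball_normE /= => zw; rewrite -pB -ltcR.
  exact: le_lt_trans (pn _) zw.
have [a Fa] : exists a, @complex.Re R @ F --> (a : R).
  by apply/cvg_ex/cvgp; [case=> ? ? [? ?]|exact: normc_ge_Re].
have [b Fb] : exists b, @complex.Im R @ F --> (b : R).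
  by apply/cvg_ex/cvgp; [case=> ? ? [? ?]|exact: normc_ge_Im].
apply/cvg_ex; exists (a +i* b); apply/fcvgrPdist_lt => e e0.
have eE := ger0_ReE (ltW e0).
have e20 : 0 < complex.Re e / 2 by rewrite divr_gt0// -ltcR -eE.
near=> z.
rewrite (le_lt_trans (normc_le_ReIm _))// eE ltcR [ltRHS]splitr ltrD//.
  have -> : complex.Re (a +i* b - z) = a - complex.Re z by case: (z).
  by near: z; move/cvgrPdist_lt: Fa; exact.
have -> : complex.Im (a +i* b - z) = b - complex.Im z by case: (z).
by near: z; move/cvgrPdist_lt: Fb; exact.
Unshelve. all: by end_near. Qed.

HB.instance Definition _ := Uniform_isComplete.Build R[i] complex_complete.
End ComplexComplete.

Section BoundedOperators.
Context {K : numFieldType} (V W : normedModType K).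

Definition bounded_op (f : V -> W) := exists M, forall x, `|f x| <= M * `|x|.

Definition bounded_linear : {pred V -> W} :=
  [pred f | `[< linear f /\ bounded_op f >]].

Lemma bounded_linearP f : reflect (linear f /\ bounded_op f) (f \in bounded_linear).
Proof. exact: asboolP. Qed.

Lemma bounded_op_ge0 f :
  bounded_op f -> exists2 M, 0 <= M & forall x, `|f x| <= M * `|x|.
Proof.
case=> M fM; exists `|M| => // x; rewrite -[`|x|]normr_id -normrM.
by rewrite ger0_norm ?fM// (le_trans _ (fM x)).
Qed.

Lemma bounded_linear_submod_closed : submod_closed bounded_linear.
Proof.
split=> [|k f g /bounded_linearP[flin /bounded_op_ge0[M M0 fM]]].
  apply/bounded_linearP; split=> [a u v|]; first by rewrite scaler0 addr0.
  by exists 0 => x; rewrite mul0r normr0.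
move=> /bounded_linearP[glin /bounded_op_ge0[N N0 gN]].
apply/bounded_linearP; split=> [a u v|].
  by rewrite /= !fctE flin glin !scalerDr !scalerA (mulrC a) addrACA.
exists (`|k| * M + N) => x; rewrite (le_trans (ler_normD _ _))// mulrDl lerD//.
by rewrite normrZ -mulrA ler_wpM2l.
Qed.

HB.instance Definition _ := GRing.isSubmodClosed.Build K (V -> W)
  bounded_linear bounded_linear_submod_closed.

Record bop := Bop { bop_fun :> V -> W; bop_funP : bop_fun \in bounded_linear }.

HB.instance Definition _ := [isSub for bop_fun].
HB.instance Definition _ := [Choice of bop by <:].
HB.instance Definition _ := [SubChoice_isSubLmodule of bop by <:].

Lemma bop_linear (f : bop) : linear f.
Proof. by have /bounded_linearP[] := bop_funP f. Qed.

Lemma bop_bounded (f : bop) : bounded_op f.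
Proof. by have /bounded_linearP[] := bop_funP f. Qed.

HB.instance Definition _ (f : bop) := GRing.isLinear.Build K V W _ f (bop_linear f).

Lemma bopP (f g : bop) : f =1 g -> f = g.
Proof. by move=> fg; apply/val_inj/funext. Qed.

End BoundedOperators.

Arguments bounded_linear {K} V W.

Section OperatorNorm.
Context {R : realType} (V W : normedModType R[i]).
Implicit Types f g : bop V W.

(* Norms over R[i] take their values in R[i], so the supremum is computed on
   real parts. *)
Definition opnorm f : R[i] :=
  (sup [set complex.Re `|f x| | x in [set x : V | `|x| <= 1]])%:C.

Let S f := [set complex.Re `|f x| | x in [set x : V | `|x| <= 1]].

Let has_supS f : has_sup (S f).
Proof.
split; first by exists (complex.Re `|f 0|), 0 => //=; rewrite normr0.
have [M M0 fM] := bounded_op_ge0 (bop_bounded f).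
exists (complex.Re M) => _ [x /= x1 <-]; rewrite -lecR -!ger0_ReE//.
by rewrite (le_trans (fM x))// ler_piMr.
Qed.

Lemma opnorm_ge0 f : 0 <= opnorm f.
Proof.
rewrite /opnorm lecR; have [_ ub] := has_supS f.
apply: le_trans (_ : complex.Re `|f 0| <= _).
  by have := normr_ge0 (f 0); rewrite [X in 0 <= X -> _]ger0_ReE// lecR.
by apply: (sup_upper_bound (has_supS f)); exists 0 => //=; rewrite normr0.
Qed.

Lemma ler_opnorm f x : `|f x| <= opnorm f * `|x|.
Proof.
have [->|x0] := eqVneq x 0; first by rewrite linear0 !normr0 mulr0.
have nx0 : 0 < `|x| by rewrite normr_gt0.
rewrite -ler_pdivrMr// (ger0_ReE (divr_ge0 _ _))// /opnorm lecR.
apply: (sup_upper_bound (has_supS f)); exists (`|x|^-1 *: x) => /=.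
  by rewrite normrZ normfV normr_id mulVf// gt_eqF.
by rewrite linearZ normrZ normfV normr_id mulrC.
Qed.

Lemma opnorm_le f M : 0 <= M -> (forall x, `|f x| <= M * `|x|) -> opnorm f <= M.
Proof.
move=> M0 fM; rewrite (ger0_ReE M0) /opnorm lecR.
apply: ge_sup; first by case: (has_supS f).
move=> _ [x /= x1 <-]; rewrite -lecR -!ger0_ReE//.
by rewrite (le_trans (fM x))// ler_piMr.
Qed.

Lemma opnormD f g : opnorm (f + g) <= opnorm f + opnorm g.
Proof.
apply: opnorm_le => [|x]; first by rewrite addr_ge0 ?opnorm_ge0.
by rewrite (le_trans (ler_normD _ _))// mulrDl lerD ?ler_opnorm.
Qed.

Lemma opnormZ k f : opnorm (k *: f) = `|k| * opnorm f.
Proof.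
have le l h : opnorm (l *: h) <= `|l| * opnorm h.
  apply: opnorm_le => [|x]; first by rewrite mulr_ge0 ?opnorm_ge0.
  by rewrite normrZ -mulrA ler_wpM2l// ler_opnorm.
apply/eqP; rewrite eq_le le/=.
have [->|k0] := eqVneq k 0; first by rewrite normr0 mul0r opnorm_ge0.
rewrite -ler_pdivlMl ?normr_gt0// -normfV.
by rewrite -{1}[f](scalerK k0) le.
Qed.

Lemma opnorm0_eq0 f : opnorm f = 0 -> f = 0.
Proof.
move=> f0; apply: bopP => x; apply/eqP; rewrite -normr_le0.
by rewrite (le_trans (ler_opnorm f x))// f0 mul0r.
Qed.

HB.instance Definition _ :=
  Lmodule_isNormed.Build R[i] (bop V W) opnormD opnormZ opnorm0_eq0.

End OperatorNorm.

Section OperatorComplete.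
Context {R : realType} (V : normedModType R[i]) (W : completeNormedModType R[i]).

Lemma bop_complete (F : set_system (bop V W)) :
  ProperFilter F -> cauchy F -> cvg F.
Proof.
move=> FF /cauchy_ballP Fc.
have Fx x : cvg ((fun f : bop V W => f x) @ F).
  apply: cauchy_cvg; apply/cauchy_ballP => e e0.
  have x1 : 0 < `|x| + 1 by rewrite ltr_wpDl.
  have d0 : 0 < e / (`|x| + 1) by rewrite divr_gt0.
  case: (Fc _ d0) => -[A B] [/= FA FB] AB.
  exists ((fun f : bop V W => f x) @` A, (fun f : bop V W => f x) @` B).
    by split; [apply: filterS FA|apply: filterS FB] => f Af; exists f.
  case=> _ _ [/= [f Af <-] [g Bg <-]]; have := AB (f, g) (conj Af Bg).
  rewrite /= -!ball_normE /= ltr_pdivlMr// => fg.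
  rewrite (le_lt_trans (ler_opnorm (f - g) x))// (le_lt_trans _ fg)//.
  by rewrite ler_wpM2l ?opnorm_ge0 ?lerDl.
pose g x := lim ((fun f : bop V W => f x) @ F).
have gE x : (fun f : bop V W => f x) @ F --> g x by exact: Fx.
have glin : linear g.
  move=> k u v; apply: cvg_lim => //.
  have -> : (fun f : bop V W => f (k *: u + v)) = (fun f => k *: f u + f v).
    by apply/funext => f; rewrite linearP.
  by apply: cvgD; [apply: cvgZr; exact: gE|exact: gE].
have Fg e : 0 < e ->
    F [set f : bop V W | forall x, `|g x - f x| <= e * `|x|].
  move=> e0; case: (Fc _ e0) => -[A B] [/= FA FB] AB.
  apply: filterS FA => f Af x; apply/ler_addgt0Pr => d d0.
  have /filter_ex[h [Bh hx]] : F (B `&` [set h : bop V W | `|g x - h x| < d]).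
    by apply: filterI => //; move/cvgrPdist_lt: (gE x); exact.
  have := AB (f, h) (conj Af Bh); rewrite /= -ball_normE /= => fh.
  rewrite -[g x](subrK (h x)) -addrA addrC (le_trans (ler_normD _ _))// lerD//.
    rewrite distrC (le_trans (ler_opnorm (f - h) x))// ler_wpM2r ?normr_ge0//.
    exact: ltW.
  exact: ltW.
have gP : g \in bounded_linear V W.
  apply/bounded_linearP; split => //.
  have /filter_ex[f fg] := Fg 1 ltr01.
  have [M fM] := bop_bounded f.
  exists (M + 1) => x; rewrite -[g x](subrK (f x)) addrC mulrDl.
  by rewrite (le_trans (ler_normD _ _))// lerD.
apply/cvg_ex; exists (Bop gP); apply/fcvgrPdist_lt => e e0.
have e20 : 0 < e / 2 by rewrite divr_gt0.
move: (Fg _ e20); apply: filterS => f fg.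
rewrite (@le_lt_trans _ _ (e / 2))//; last by rewrite ltr_pdivrMr// ltr_pMr// ltr1n.
by apply: (@opnorm_le _ _ _ (Bop gP - f)) => //; exact: ltW.
Qed.

HB.instance Definition _ := Uniform_isComplete.Build (bop V W) bop_complete.

End OperatorComplete.

Definition dual {R : realType} (V : normedModType R[i]) : Type := bop V R[i].
HB.instance Definition _ (R : realType) (V : normedModType R[i]) :=
  CompleteNormedModule.on (dual V).

Reserved Notation "a ** b" (at level 40, left associativity).

(* Banach algebras are not assumed unital, hence do not extend pzRingType. *)
HB.mixin Record CompleteNormedModule_isBanachAlgebra (K : numFieldType) A
    & CompleteNormedModule K A := {
  bmul : A -> A -> A;
  bmulA : associative bmul;
  bmulDl : left_distributive bmul +%R;
  bmulDr : right_distributive bmul +%R;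
  bmulZl : forall k a b, bmul (k *: a) b = k *: bmul a b;
  bmulZr : forall k a b, bmul a (k *: b) = k *: bmul a b;
  ler_norm_bmul : forall a b, `|bmul a b| <= `|a| * `|b|
}.

#[short(type="banachAlgType")]
HB.structure Definition BanachAlgebra (K : numFieldType) :=
  {A of CompleteNormedModule K A & CompleteNormedModule_isBanachAlgebra K A}.

Notation "a ** b" := (bmul a b) : ring_scope.

(* The actions are jointly bounded, with a constant that need not be 1. *)
HB.mixin Record CompleteNormedModule_isBanachBimodule (K : numFieldType)
    (A : banachAlgType K) X & CompleteNormedModule K X := {
  lact : A -> X -> X;
  ract : X -> A -> X;
  lactDl : forall a b x, lact (a + b) x = lact a x + lact b x;
  lactDr : forall a x y, lact a (x + y) = lact a x + lact a y;
  lactZl : forall k a x, lact (k *: a) x = k *: lact a x;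
  lactZr : forall k a x, lact a (k *: x) = k *: lact a x;
  lactA : forall a b x, lact a (lact b x) = lact (a ** b) x;
  ractDl : forall x y a, ract (x + y) a = ract x a + ract y a;
  ractDr : forall x a b, ract x (a + b) = ract x a + ract x b;
  ractZl : forall k x a, ract (k *: x) a = k *: ract x a;
  ractZr : forall k x a, ract x (k *: a) = k *: ract x a;
  ractA : forall x a b, ract x (a ** b) = ract (ract x a) b;
  lractA : forall a x b, lact a (ract x b) = ract (lact a x) b;
  lact_bounded : exists M, forall a x, `|lact a x| <= M * `|a| * `|x|;
  ract_bounded : exists M, forall x a, `|ract x a| <= M * `|x| * `|a|
}.

#[short(type="bimodType")]
HB.structure Definition BanachBimodule (K : numFieldType) (A : banachAlgType K) :=
  {X of CompleteNormedModule K X & CompleteNormedModule_isBanachBimodule K A X}.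

Definition self_bimod {K : numFieldType} (A : banachAlgType K) : Type := A.

Section SelfBimodule.
Context {K : numFieldType} (A : banachAlgType K).
HB.instance Definition _ := CompleteNormedModule.on (self_bimod A).

Let bmul_bounded : exists M : K, forall a b : A, `|a ** b| <= M * `|a| * `|b|.
Proof. by exists 1 => a b; rewrite mul1r ler_norm_bmul. Qed.

HB.instance Definition _ :=
  @CompleteNormedModule_isBanachBimodule.Build K A (self_bimod A)
    (@bmul K A) (@bmul K A)
    bmulDl bmulDr bmulZl bmulZr bmulA bmulDl bmulDr bmulZl bmulZr
    bmulA bmulA bmul_bounded bmul_bounded.

End SelfBimodule.

Section DualBounds.
Context {R : realType} {V W : normedModType R[i]}.

Lemma dual_comp_subproof (L : dual W) (T : V -> W) :
  T \in bounded_linear V W -> (fun x => L (T x)) \in bounded_linear V R[i].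
Proof.
move=> /bounded_linearP[Tlin [M TM]]; apply/bounded_linearP; split=> [k u v|].
  by rewrite Tlin linearP.
exists (opnorm L * M) => x; rewrite (le_trans (ler_opnorm L _))//.
by rewrite -mulrA ler_wpM2l ?opnorm_ge0.
Qed.

Lemma dual_norm_le (L : dual V) M :
  0 <= M -> (forall x, `|L x| <= M * `|x|) -> `|L| <= M.
Proof. exact: opnorm_le. Qed.

Lemma ler_dual_norm (L : dual V) x : `|L x| <= `|L| * `|x|.
Proof. exact: ler_opnorm. Qed.

End DualBounds.

(* <x, a . L> = <x . a, L> and <x, L . a> = <a . x, L>. *)
Section DualBimodule.
Context {R : realType} {A : banachAlgType R[i]} {X : bimodType A}.
Implicit Types (a b : A) (x y : X) (L : dual X).

Let lact_bnd : exists2 M, 0 <= M & forall a x, `|lact a x| <= M * `|a| * `|x|.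
Proof.
have [M Ml] := @lact_bounded _ A X.
exists `|M| => // a x; rewrite -[`|lact a x|]normr_id.
rewrite -[X in _ <= _ * X * _]normr_id -[X in _ <= _ * X]normr_id -!normrM.
by rewrite normr_id [leRHS]ger0_norm ?Ml// (le_trans _ (Ml a x)).
Qed.

Let ract_bnd : exists2 M, 0 <= M & forall x a, `|ract x a| <= M * `|x| * `|a|.
Proof.
have [M Mr] := @ract_bounded _ A X.
exists `|M| => // x a; rewrite -[`|ract x a|]normr_id.
rewrite -[X in _ <= _ * X * _]normr_id -[X in _ <= _ * X]normr_id -!normrM.
by rewrite normr_id [leRHS]ger0_norm ?Mr// (le_trans _ (Mr x a)).
Qed.

Let lactP a : (fun x : X => lact a x) \in bounded_linear X X.
Proof.
apply/bounded_linearP; split=> [k u v|]; first by rewrite lactDr lactZr.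
by have [M _ Ml] := lact_bnd; exists (M * `|a|).
Qed.

Let ractP a : (fun x : X => ract x a) \in bounded_linear X X.
Proof.
apply/bounded_linearP; split=> [k u v|]; first by rewrite ractDl ractZl.
by have [M _ Mr] := ract_bnd; exists (M * `|a|) => x; rewrite mulrAC.
Qed.

Definition dual_lact a L : dual X := Bop (dual_comp_subproof L (ractP a)).

Definition dual_ract L a : dual X := Bop (dual_comp_subproof L (lactP a)).

Let dual_lact_bounded : exists M, forall a L, `|dual_lact a L| <= M * `|a| * `|L|.
Proof.
have [M M0 Mr] := ract_bnd; exists M => a L.
apply: dual_norm_le => [|x /=]; first by rewrite !mulr_ge0.
rewrite (le_trans (ler_dual_norm L _))// mulrAC mulrC ler_wpM2r//.
by rewrite (le_trans (Mr x a))// mulrAC.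
Qed.

Let dual_ract_bounded : exists M, forall L a, `|dual_ract L a| <= M * `|L| * `|a|.
Proof.
have [M M0 Ml] := lact_bnd; exists M => L a.
apply: dual_norm_le => [|x /=]; first by rewrite !mulr_ge0.
have -> : M * `|L| * `|a| * `|x| = `|L| * (M * `|a| * `|x|).
  by rewrite -!mulrA mulrCA.
by rewrite (le_trans (ler_dual_norm L _))// ler_wpM2l.
Qed.

Let dual_lactDl a b L : dual_lact (a + b) L = dual_lact a L + dual_lact b L.
Proof. by apply: bopP => x /=; rewrite ractDr linearD. Qed.

Let dual_lactDr a L K : dual_lact a (L + K) = dual_lact a L + dual_lact a K.
Proof. exact: bopP. Qed.

Let dual_lactZl k a L : dual_lact (k *: a) L = k *: dual_lact a L.
Proof. by apply: bopP => x /=; rewrite ractZr linearZ. Qed.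

Let dual_lactZr k a L : dual_lact a (k *: L) = k *: dual_lact a L.
Proof. exact: bopP. Qed.

Let dual_lactA a b L : dual_lact a (dual_lact b L) = dual_lact (a ** b) L.
Proof. by apply: bopP => x /=; rewrite ractA. Qed.

Let dual_ractDl L K a : dual_ract (L + K) a = dual_ract L a + dual_ract K a.
Proof. exact: bopP. Qed.

Let dual_ractDr L a b : dual_ract L (a + b) = dual_ract L a + dual_ract L b.
Proof. by apply: bopP => x /=; rewrite lactDl linearD. Qed.

Let dual_ractZl k L a : dual_ract (k *: L) a = k *: dual_ract L a.
Proof. exact: bopP. Qed.

Let dual_ractZr k L a : dual_ract L (k *: a) = k *: dual_ract L a.
Proof. by apply: bopP => x /=; rewrite lactZl linearZ. Qed.

Let dual_ractA L a b : dual_ract L (a ** b) = dual_ract (dual_ract L a) b.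
Proof. by apply: bopP => x /=; rewrite lactA. Qed.

Let dual_lractA a L b :
  dual_lact a (dual_ract L b) = dual_ract (dual_lact a L) b.
Proof. by apply: bopP => x /=; rewrite lractA. Qed.

HB.instance Definition _ :=
  @CompleteNormedModule_isBanachBimodule.Build R[i] A (dual X)
    dual_lact dual_ract
    dual_lactDl dual_lactDr dual_lactZl dual_lactZr dual_lactA
    dual_ractDl dual_ractDr dual_ractZl dual_ractZr dual_ractA
    dual_lractA dual_lact_bounded dual_ract_bounded.

End DualBimodule.

(* The second dual of A, as a type carrying the first Arens product. *)
Definition arens {R : realType} (A : banachAlgType R[i]) : Type := dual (dual A).

Section ArensProduct.
Context {R : realType} (A : banachAlgType R[i]).
Implicit Types (a b : A) (f : dual A) (m n : arens A).

HB.instance Definition _ := CompleteNormedModule.on (arens A).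

Let bmulP a : (fun b => a ** b) \in bounded_linear A A.
Proof.
apply/bounded_linearP; split=> [k u v|]; first by rewrite bmulDr bmulZr.
by exists `|a| => b; exact: ler_norm_bmul.
Qed.

(* <f [] a, b> = <f, ab> *)
Definition arens_fa f a : dual A := Bop (dual_comp_subproof f (bmulP a)).

Lemma ler_norm_arens_fa f a : `|arens_fa f a| <= `|f| * `|a|.
Proof.
apply: dual_norm_le => [|b /=]; first by rewrite mulr_ge0.
by rewrite (le_trans (ler_dual_norm f _))// -mulrA ler_wpM2l// ler_norm_bmul.
Qed.

Let arens_faP f : (fun a => arens_fa f a) \in bounded_linear A (dual A).
Proof.
apply/bounded_linearP; split=> [k u v|].
  by apply: bopP => b /=; rewrite bmulDl bmulZl linearP.
by exists `|f| => a; exact: ler_norm_arens_fa.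
Qed.

(* <m [] f, a> = <m, f [] a> *)
Definition arens_mf m f : dual A :=
  Bop (dual_comp_subproof (m : dual (dual A)) (arens_faP f)).

Lemma ler_norm_arens_mf m f : `|arens_mf m f| <= `|m| * `|f|.
Proof.
apply: dual_norm_le => [|a /=]; first by rewrite mulr_ge0.
rewrite (le_trans (ler_dual_norm (m : dual (dual A)) _))// -mulrA ler_wpM2l//.
exact: ler_norm_arens_fa.
Qed.

Let arens_mfP m : (fun f => arens_mf m f) \in bounded_linear (dual A) (dual A).
Proof.
apply/bounded_linearP; split=> [k f g|].
  apply: bopP => a /=.
  have -> : arens_fa (k *: f + g) a = k *: arens_fa f a + arens_fa g a.
    exact: bopP.
  exact: linearP.
by exists `|m| => f; exact: ler_norm_arens_mf.
Qed.

(* <m [] n, f> = <m, n [] f> *)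
Definition arens_mul m n : arens A :=
  Bop (dual_comp_subproof (m : dual (dual A)) (arens_mfP n)).

Let arens_mulA : associative arens_mul.
Proof.
move=> m n p; apply: bopP => f /=; congr (bop_fun m _).
apply: bopP => a /=; congr (bop_fun n _).
apply: bopP => b /=; congr (bop_fun p _).
by apply: bopP => c /=; rewrite bmulA.
Qed.

Let arens_mulDl : left_distributive arens_mul +%R.
Proof. by move=> m n p; exact: bopP. Qed.

Let arens_mulDr : right_distributive arens_mul +%R.
Proof.
move=> m n p; apply: bopP => f /=.
have -> : arens_mf (n + p) f = arens_mf n f + arens_mf p f by exact: bopP.
exact: (linearD (m : bop _ _)).
Qed.

Let arens_mulZl k m n : arens_mul (k *: m) n = k *: arens_mul m n.
Proof. exact: bopP. Qed.

Let arens_mulZr k m n : arens_mul m (k *: n) = k *: arens_mul m n.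
Proof.
apply: bopP => f /=.
have -> : arens_mf (k *: n) f = k *: arens_mf n f by exact: bopP.
exact: (linearZ_LR (m : bop _ _)).
Qed.

Let ler_norm_arens_mul m n : `|arens_mul m n| <= `|m| * `|n|.
Proof.
apply: (@dual_norm_le _ (dual A)) => [|f /=]; first by rewrite mulr_ge0.
rewrite (le_trans (ler_dual_norm (m : dual (dual A)) _))// -mulrA ler_wpM2l//.
exact: ler_norm_arens_mf.
Qed.

HB.instance Definition _ :=
  CompleteNormedModule_isBanachAlgebra.Build R[i] (arens A)
    arens_mulA arens_mulDl arens_mulDr arens_mulZl arens_mulZr
    ler_norm_arens_mul.

End ArensProduct.

Definition directed (I : Type) (le : I -> I -> Prop) :=
  [/\ inhabited I, (forall i, le i i),
      (forall i j k, le i j -> le j k -> le i k) &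
      (forall i j, exists k, le i k /\ le j k)].

(* f @ net_filter le --> l is convergence of the net f : I -> X to l. *)
Definition net_filter (I : Type) (le : I -> I -> Prop) : set_system I :=
  filter_from [set: I] (fun i => [set j | le i j]).

Section Derivations.
Context {K : numFieldType} {A : banachAlgType K} {X : bimodType A}.
Implicit Types D : A -> X.

Definition derivation D :=
  linear D /\ forall a b, D (a ** b) = lact a (D b) + ract (D a) b.

Definition approx_inner D :=
  exists (I : Type) (le : I -> I -> Prop) (x : I -> X), directed le /\
    forall a, lact a (x i) - ract (x i) a @[i --> net_filter le] --> D a.

End Derivations.

Section Amenability.
Context {R : realType} (A : banachAlgType R[i]).

Definition approx_amenable := forall (X : bimodType A) (D : A -> dual X),
  derivation D -> bounded_op D -> approx_inner D.

Definition approx_weakly_amenable := forall D : A -> dual (self_bimod A),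
  derivation D -> bounded_op D -> approx_inner D.

End Amenability.

Section WeaklyCompact.
Context {R : realType}.

(* The weak topology: the initial topology for all bounded functionals. *)
Definition weak_space (V : normedModType R[i]) : topologicalType :=
  sup_topology (fun f : dual V => Topological.on (initial_topology (f : V -> R[i]))).

Definition weakly_compact {V W : normedModType R[i]} (T : V -> W) :=
  precompact (T @` [set x | `|x| <= 1] : set (weak_space W)).

Definition wcompact_ops (V W : normedModType R[i]) : set (bop V W) :=
  [set T : bop V W | weakly_compact T].

End WeaklyCompact.

Arguments wcompact_ops {R} V W.

(* Main.v *)
(* A derivation D : A -> X extends to the derivation D** from the first Arens
   algebra A** to the A**-bimodule X**.

   (i) For X = Y* the bimodule X** need not be the dual of an A**-bimodule, but it
   embeds into its own second dual, where D** becomes approximately inner. On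
   finitely many a_i this says that every family (phi_i) in X* whose combination
   sum_i (phi_i . a_i - a_i . phi_i) vanishes has sum_i phi_i (D a_i) = 0; by
   Hahn-Banach, (D a_i) lies in the closure of the subspace of the families
   (a_i . x - x . a_i), x in X.

   (ii) For X = A*, weak compactness of all operators A -> A* makes D** a
   derivation for the dual module structure on A***, and restricting the
   functionals that approximate D** to A gives a net in A*. *)
Require Import Defs.
From HB Require Import structures.
From mathcomp Require Import all_boot all_order all_algebra.
From mathcomp Require Import complex.
From mathcomp Require Import boolp classical_sets functions reals.
From mathcomp Require Import topology normedtype.
From mathcomp Require Import lra.

Set Implicit Arguments.
Unset Strict Implicit.
Unset Printing Implicit Defensive.

Import Order.TTheory GRing.Theory Num.Theory.
Import numFieldNormedType.Exports.

Local Open Scope classical_set_scope.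
Local Open Scope ring_scope.
Local Open Scope complex_scope.

(** * The Hahn-Banach theorem for complex seminorms *)

Section HahnBanach.
Context {R : realType} {E : lmodType R[i]}.
Implicit Types (p q : E -> R) (x y : E).

(** An inequality for positive real factors suffices, as scaling back by the inverse gives equality;
    it is also easier to verify for infima. *)
Definition sublinear p :=
  (forall x y, p (x + y) <= p x + p y) /\
  (forall (r : R) x, 0 < r -> p (r%:C *: x) <= r * p x).

Lemma sublinearZ p r x : sublinear p -> 0 < r -> p (r%:C *: x) = r * p x.
Proof.
move=> [_ pZ] r0; apply/eqP; rewrite eq_le pZ//= -ler_pdivlMl//.
apply: le_trans (pZ _ _ _); last by rewrite invr_gt0.
by rewrite scalerA -rmorphM/= mulVf ?gt_eqF// scale1r.
Qed.

Lemma sublinear0 p : sublinear p -> p 0 = 0.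
Proof.
move=> ps; have := @sublinearZ _ 2 0 ps (ltr0Sn _ _).
by rewrite scaler0; lra.
Qed.

Lemma sublinear_ge p x : sublinear p -> - p (- x) <= p x.
Proof.
by move=> ps; have := ps.1 x (- x); rewrite subrr sublinear0//; lra.
Qed.

(** The members need not be sublinear: some index [k] only has to absorb a sum or a scaling. This
    covers shifts along a ray, chains in Zorn's lemma, and distances to the range of operators. *)
Lemma inf_sublinear (J : Type) (g : J -> E -> R) :
  inhabited J ->
  (forall x, exists b, forall j, b <= g j x) ->
  (forall i j x y, exists k, g k (x + y) <= g i x + g j y) ->
  (forall r i x, 0 < r -> exists k, g k (r%:C *: x) <= r * g i x) ->
  sublinear (fun x => inf [set g j x | j in [set: J]]) /\
  forall x j, inf [set g j x | j in [set: J]] <= g j x.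
Proof.
move=> [j0] lb gD gZ.
have hlb x : has_lbound [set g j x | j in [set: J]].
  by have [b bP] := lb x; exists b => _ [j _ <-].
have le x j : inf [set g j x | j in [set: J]] <= g j x.
  by apply: ge_inf => //; exists j.
have hi x : has_inf [set g j x | j in [set: J]].
  by split; [exists (g j0 x), j0|exact: hlb].
split=> //; split=> [x y|r x r0].
  apply/ler_addgt0Pr => e e0; have e2 : 0 < e / 2 by rewrite divr_gt0.
  have [_ [i _ <-] ix] := inf_adherent e2 (hi x).
  have [_ [j _ <-] jy] := inf_adherent e2 (hi y).
  have [k kP] := gD i j x y; apply: le_trans (le _ k) _.
  by apply: (le_trans kP); lra.
apply/ler_addgt0Pr => e e0; have er : 0 < e / r by rewrite divr_gt0.
have [_ [i _ <-] ix] := inf_adherent er (hi x).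
have [k kP] := gZ r i x r0; apply: le_trans (le _ k) _; apply: (le_trans kP).
rewrite -[e](@divfK _ r) ?gt_eqF// [X in _ + X]mulrC -mulrDr.
by rewrite ler_wpM2l ?ltW.
Qed.

(* A minimal sublinear functional is unchanged by this, and hence additive. *)
Lemma sublinear_lower p y : sublinear p ->
  exists q, [/\ sublinear q, forall x, q x <= p x &
                forall x, q x <= p (x + y) - p y].
Proof.
move=> ps.
(* The infimum of [p (x + t y) - t p y] over [t >= 0]: the value [t = 0] gives the first bound,
   [t = 1] the second. *)
pose J := {t : R | 0 <= t}.
pose g (t : J) x := p (x + (sval t)%:C *: y) - sval t * p y.
have pZ0 t : 0 <= t -> p (t%:C *: y) = t * p y.
  rewrite le_eqVlt => /predU1P[<-|t0]; last exact: sublinearZ.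
  by rewrite scale0r mul0r sublinear0.
have [| | | |qs qg] := @inf_sublinear J g.
- by constructor; exists 0.
- move=> x; exists (- p (- x)) => -[t t0]; rewrite /g /=.
  have := ps.1 (x + t%:C *: y) (- x).
  by rewrite addrAC subrr add0r pZ0//; lra.
- move=> [t t0] [u u0] x z; exists (exist _ (t + u) (addr_ge0 t0 u0)); rewrite /g /=.
  rewrite rmorphD/= scalerDl addrACA mulrDl.
  by have := ps.1 (x + t%:C *: y) (z + u%:C *: y); lra.
- move=> r [t t0] x r0; exists (exist _ (r * t) (mulr_ge0 (ltW r0) t0)).
  by rewrite /g /= rmorphM/= -scalerA -scalerDr sublinearZ// mulrBr mulrA.
exists (fun x => inf [set g j x | j in [set: J]]); split => // x.
  by have := qg x (exist _ 0 (lexx 0)); rewrite /g /= scale0r addr0 mul0r subr0.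
have := qg x (exist _ 1 ler01).
by rewrite /g /= scale1r mul1r.
Qed.

(** Zorn's lemma for the reversed pointwise order. A nonempty chain is bounded by its infimum,
    finite since every member is at least [- q (- x)]; an empty chain is bounded by [q]. *)
Lemma sublinear_minimal q : sublinear q ->
  exists2 p, sublinear p /\ (forall x, p x <= q x) &
    forall p', sublinear p' -> (forall x, p' x <= p x) -> p' = p.
Proof.
move=> qs.
pose P p := sublinear p /\ forall x, p x <= q x; pose T := {p | P p}.
pose le (s t : T) := `[< forall x, sval t x <= sval s x >].
have svalI (s t : T) : sval s = sval t -> s = t.
  by move: s t => [s sP] [t tP] /= st; exact: eq_exist.
have [| | | |[p [ps pq]] pmin] := @Zorn T le.
- by move=> t; apply/asboolP.
- by move=> r s t /asboolP rs /asboolP st; apply/asboolP => x; apply: le_trans (rs x).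
- move=> s t /asboolP st /asboolP ts; apply/svalI/funext => x.
  by apply/eqP; rewrite eq_le st ts.
- move=> A Atot; have [A0|/nonemptyPn A0] := pselect (A !=set0); last first.
    by exists (exist _ q (conj qs (fun=> lexx _))) => s; rewrite A0.
  pose J := {s | A s}.
  pose g (s : J) := sval (sval s).
  have gs (s : J) : sublinear (g s) by case: s => -[? []].
  have [| | | |hs hg] := @inf_sublinear J g.
  + by case: A0 => s As; constructor; exists s.
  + move=> x; exists (- q (- x)) => s; apply: le_trans (sublinear_ge x (gs s)).
    by rewrite lerN2; case: s => -[? []].
  + move=> i j x y; have [] := Atot _ _ (svalP i) (svalP j) => /asboolP ij.
      by exists j; rewrite (le_trans ((gs j).1 x y))// lerD2r; exact: ij.
    by exists i; rewrite (le_trans ((gs i).1 x y))// lerD2l; exact: ij.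
  + by move=> r i x r0; exists i; exact: (gs i).2.
  have hq x : inf [set g j x | j in [set: J]] <= q x.
    case: A0 => s As; apply: (le_trans (hg x (exist _ s As))).
    by rewrite /g /=; case: (svalP s).
  exists (exist P _ (conj hs hq)) => s As; apply/asboolP => x /=.
  exact: (hg x (exist _ s As)).
exists p => // p' ps' pp'.
have pq' x : p' x <= q x by apply: le_trans (pp' x) (pq x).
have := pmin (exist P p' (conj ps' pq')) (introT (asboolP _) pp').
by move/(congr1 sval).
Qed.

(** Lowering [q] along [x0] before minimizing gives [q0 (- x0) <= - q x0], which forces
    [f x0 >= q x0]. Lowering the minimal [f] along [y] cannot change it, hence
    [f x <= f (x + y) - f y]. *)
Lemma sublinear_dominates q x0 : sublinear q ->
  exists f : E -> R, [/\ forall x y, f (x + y) = f x + f y,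
    forall (r : R) x, f (r%:C *: x) = r * f x, forall x, f x <= q x &
    f x0 = q x0].
Proof.
move=> qs; have [q0 [q0s q0q q0x]] := sublinear_lower x0 qs.
have [f [fs fq0] fmin] := sublinear_minimal q0s.
have fD x y : f (x + y) = f x + f y.
  apply/eqP; rewrite eq_le fs.1/=.
  have [p [ps pf py]] := sublinear_lower y fs.
  by have := py x; rewrite (fmin _ ps pf) lerBrDr.
have fN x : f (- x) = - f x.
  by apply/eqP; rewrite -subr_eq0 opprK addrC -fD subrr sublinear0.
exists f; split=> // [r x|x|]; last 1 first.
- apply/eqP; rewrite eq_le (le_trans (fq0 _) (q0q _))/= -lerN2 -fN.
  rewrite (le_trans (fq0 _))// (le_trans (q0x _))//.
  by rewrite addNr sublinear0// sub0r.
- have [r0|r0|->] := ltgtP r 0; last by rewrite scale0r mul0r sublinear0.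
    by rewrite -[r]opprK rmorphN/= scaleNr fN sublinearZ ?oppr_gt0// !mulNr.
  exact: sublinearZ.
- exact: le_trans (fq0 _) (q0q _).
Qed.

(* The complex functional with real part f is x |-> f x - i f (i x). *)
Theorem hahn_banach_seminorm q x0 : sublinear q ->
    (forall (k : R[i]) x, `|k| = 1 -> q (k *: x) = q x) ->
  exists F : E -> R[i], [/\ linear F, forall x, `|F x| <= (q x)%:C &
    (q x0)%:C <= `|F x0|].
Proof.
move=> qs qU; have [f [fD fZ fq fx0]] := sublinear_dominates x0 qs.
pose F x : R[i] := f x +i* - f ('i%C *: x).
have FD x y : F (x + y) = F x + F y by rewrite /F scalerDr !fD; simpc.
have fi z : f ('i%C *: ('i%C *: z)) = - f z.
  by rewrite scalerA -expr2 sqr_i (_ : -1 = (-1)%:C) ?fZ ?mulN1r// rmorphN.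
have fk k x : f (k *: x) = complex.Re k * f x + complex.Im k * f ('i%C *: x).
  by rewrite {1}[k]complexE scalerDl fD mulrC -scalerA !fZ.
have FZ k x : F (k *: x) = k * F x.
  have ik : 'i%C *: (k *: x) = k *: ('i%C *: x) by rewrite !scalerA mulrC.
  rewrite /F ik (fk k x) (fk k ('i%C *: x)) fi.
  by case: (k) => a b /=; simpc; congr (_ +i* _); lra.
have Fle x : `|F x| <= (q x)%:C.
  have [Fx0|Fx0] := eqVneq (F x) 0.
    have := sublinear_ge x qs; rewrite -scaleN1r qU ?normrN1// => qx.
    by rewrite Fx0 normr0 lecR; lra.
  (* Rotation by the unimodular [c] makes [F (c x)] real and equal to the modulus of [F x], so the
     bound on the real part applies. *)
  pose c := (F x)^-1 * `|F x|.
  have c1 : `|c| = 1 by rewrite normrM normfV normr_id mulVf// normr_eq0.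
  have -> : `|F x| = F (c *: x) by rewrite FZ /c mulrAC mulVf ?mul1r.
  have : 0 <= F (c *: x) by rewrite FZ /c mulrAC mulVf ?mul1r.
  by move/ger0_ReE => ->; rewrite lecR /= -(qU c)//.
exists F; split => // [k x y|]; first by rewrite FD FZ.
rewrite -fx0; have -> : f x0 = complex.Re (F x0) by [].
apply: le_trans (normc_ge_Re _) => //.
by rewrite lecR ler_norm.
Qed.

End HahnBanach.

(** * Simultaneous approximation by duality *)

Section NormDuality.
Context {R : realType}.

Definition rnorm (V : normedModType R[i]) (x : V) : R := complex.Re `|x|.

Lemma rnormE (V : normedModType R[i]) (x : V) : (rnorm x)%:C = `|x|.
Proof. by rewrite -ger0_ReE. Qed.

Lemma rnorm_ge0 (V : normedModType R[i]) (x : V) : 0 <= rnorm x.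
Proof. by rewrite -lecR rnormE; exact: normr_ge0. Qed.

Lemma ler_rnormD (V : normedModType R[i]) (x y : V) :
  rnorm (x + y) <= rnorm x + rnorm y.
Proof. by rewrite -lecR rmorphD/= !rnormE ler_normD. Qed.

Lemma rnormZ (V : normedModType R[i]) (k : R[i]) (x : V) :
  rnorm (k *: x) = rnorm k * rnorm x.
Proof.
by rewrite {1}/rnorm normrZ -2!rnormE -rmorphM.
Qed.

(* The infimum over x of the left-hand side of the conclusion is a seminorm of
   the family z, so that Hahn-Banach provides a functional norming it. *)
Lemma dual_approximation (V W : normedModType R[i]) (I : finType)
    (L : I -> bop V W) (z : I -> W) (k N c d : R) :
  0 <= k -> 0 <= N ->
  (forall phi : I -> dual W,
    (forall x, `|\sum_i phi i (L i x)| <= k%:C * `|x|) ->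
    (forall i, `|phi i| <= N%:C) -> `|\sum_i phi i (z i)| <= c%:C) ->
  c < d ->
  exists x, k%:C * `|x| + N%:C * \sum_i `|z i - L i x| < d%:C.
Proof.
move=> k0 N0 ub cd.
pose E : lmodType R[i] := I -> W.
pose g (x : V) (y : E) := k * rnorm x + N * \sum_i rnorm (y i - L i x).
have g0 x y : 0 <= g x y.
  by rewrite addr_ge0// mulr_ge0 ?rnorm_ge0// sumr_ge0// => i _; exact: rnorm_ge0.
have gZ (a : R[i]) x y : g (a *: x) (a *: y) = rnorm a * g x y.
  rewrite /g rnormZ mulrDr mulrCA; congr (_ + _); rewrite mulrCA [in RHS]mulr_sumr.
  by congr (_ * _); apply: eq_bigr => i _; rewrite linearZ -scalerBr rnormZ.
have [| | | |] := @inf_sublinear R E V g.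
- by constructor; exact: 0.
- by move=> y; exists 0.
- move=> x x' y y'; exists (x + x'); rewrite /g.
  rewrite addrACA -!mulrDr lerD ?ler_wpM2l ?ler_rnormD// -big_split/=.
  apply: ler_sum => i _; rewrite linearD opprD addrACA; exact: ler_rnormD.
- move=> r x y r0; exists (r%:C *: x); rewrite gZ.
  by rewrite {1}/rnorm normc_def/= expr0n addr0 sqrtr_sqr gtr0_norm.
set q := fun y => _ => qs qg.
have q_le (a : R[i]) y : `|a| = 1 -> q (a *: y) <= q y.
  move=> a1; apply: lb_le_inf; first by exists (g 0 y), 0.
  move=> _ [x _ <-]; apply: le_trans (qg _ (a *: x)) _.
  by rewrite gZ /rnorm a1 mul1r.
have qU (a : R[i]) y : `|a| = 1 -> q (a *: y) = q y.
  move=> a1; apply/eqP; rewrite eq_le q_le//= -{1}[y](@scalerK _ _ a) ?q_le//.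
    by rewrite normfV a1 invr1.
  by rewrite -normr_eq0 a1 oner_eq0.
have [F [Flin Fq Fz]] := hahn_banach_seminorm z qs qU.
pose Flinear := GRing.isLinear.Build R[i] E R[i] _ F Flin.
pose FL : {linear E -> R[i]} := HB.pack F Flinear.
pose delta i (w : W) : E := fun j => if j == i then w else 0.
have deltaP i : linear (delta i).
  move=> a u v; apply/funext => j; rewrite /delta !fctE.
  by case: (j == i); rewrite ?scaler0 ?addr0.
(* The two hypotheses of [ub] come from two candidates in the infimum [q]: the vector [0] here, and
   [x] itself for the family [L i x] below. *)
have phib i w : `|F (delta i w)| <= N%:C * `|w|.
  apply: (le_trans (Fq _)); rewrite -rnormE -rmorphM lecR.
  apply: (le_trans (qg _ 0)); rewrite /g /rnorm normr0 mulr0 add0r.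
  rewrite (bigD1 i)//= /delta eqxx linear0 subr0 big1 ?addr0// => j ji.
  by rewrite (negbTE ji) linear0 subr0 normr0.
have phiP i : (fun w => F (delta i w)) \in bounded_linear W R[i].
  apply/bounded_linearP; split; last by exists N%:C.
  by move=> a u v; rewrite deltaP Flin.
pose phi i : dual W := Bop (phiP i).
have FE (y : E) : \sum_i phi i (y i) = F y.
  rewrite -[F y]/(FL y).
  have {2}-> : y = \sum_i delta i (y i).
    apply/funext => j; rewrite fct_sumE (bigD1 j)//= /delta eqxx big1 ?addr0//.
    by move=> i; rewrite eq_sym => /negbTE ->.
  by rewrite linear_sum.
have : `|F z| <= c%:C.
  rewrite -FE; apply: ub => [x|i]; last first.
    by apply: dual_norm_le => [|w]; [rewrite lecR|exact: phib].
  rewrite (FE (fun i => L i x)) (le_trans (Fq _))// -rnormE -rmorphM lecR.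
  apply: le_trans (qg _ x) _; rewrite /g big1 ?mulr0 ?addr0// => i _.
  by rewrite subrr /rnorm normr0.
move=> /(le_trans Fz); rewrite lecR => /le_lt_trans/(_ cd).
move=> /inf_lt[|_ [x _ <-] gd]; first by exists (g 0 z), 0.
exists x; rewrite -rnormE (eq_bigr (fun i => (rnorm (z i - L i x))%:C)).
  by rewrite -rmorph_sum -!rmorphM -rmorphD ltcR.
by move=> i _; rewrite rnormE.
Qed.

End NormDuality.

(** * Approximate innerness on finite sets *)

Section ApproximatelyInner.
Context {R : realType} {A : banachAlgType R[i]} {X : bimodType A}.

Lemma net_filter_proper (I : Type) (le : I -> I -> Prop) :
  directed le -> ProperFilter (net_filter le).
Proof.
move=> [[i0] lexx le_trans ub]; apply: filter_from_proper => [|i _]; last by exists i.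
apply: filter_from_filter; first by exists i0.
move=> i j _ _; have [k [ik jk]] := ub i j.
by exists k => // l kl; split; apply: le_trans kl.
Qed.

(** Pairs of a finite list and a tolerance form a directed set, and a choice of one vector for each
    pair is the required net. *)
Lemma approx_innerP (D : A -> X) : approx_inner D <->
  forall (s : seq A) (e : R[i]), 0 < e ->
    exists x, forall a, a \in s -> `|D a - (lact a x - ract x a)| < e.
Proof.
split=> [[I [le [x [dir cvgx]]]] s e e0|near].
  have PF := net_filter_proper dir.
  suff : \forall i \near net_filter le, forall a, a \in s ->
      `|D a - (lact a (x i) - ract (x i) a)| < e.
    by move=> /filter_ex[i xi]; exists (x i).
  elim: s => [|a s IHs]; first exact: nearW.
  move/cvgrPdist_lt: (cvgx a) => /(_ _ e0) ea.
  by apply: filterS2 ea IHs => i ea IHs b; rewrite inE => /predU1P[->|/IHs].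
pose pos (e : R) : Prop := 0 < e; pose I := (seq A * {e | pos e})%type.
pose le (i j : I) := {subset i.1 <= j.1} /\ sval j.2 <= sval i.2.
have /choice[x xP] (i : I) : exists x, forall a, a \in i.1 ->
    `|D a - (lact a x - ract x a)| < (sval i.2)%:C.
  by apply: near; rewrite ltcR; case: (i.2).
have dir : directed le.
  split.
  - by constructor; exact: ([::], exist pos 1 ltr01).
  - by move=> i; split.
  - move=> i j k [ij ji] [jk kj]; split; first by move=> a /ij /jk.
    exact: le_trans kj ji.
  - move=> [s [e e0]] [t [d d0]].
    have ed0 : 0 < Num.min e d by rewrite lt_min e0.
    exists (s ++ t, exist pos _ ed0); split; split=> /=.
    + by move=> a; rewrite mem_cat => ->.
    + by rewrite ge_min lexx.
    + by move=> a; rewrite mem_cat orbC => ->.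
    + by rewrite ge_min lexx orbT.
exists I, le, x; split=> // a; have PF := net_filter_proper dir.
apply/cvgrPdist_lt => e e0.
have e0' : 0 < complex.Re e by rewrite -ltcR -ger0_ReE ?ltW.
exists ([:: a], exist pos _ e0') => // i [ai ie] /=.
apply: (lt_le_trans (xP i a (ai _ (mem_head _ _)))).
by rewrite (ger0_ReE (ltW e0)) lecR.
Qed.

End ApproximatelyInner.

(** * Adjoints of bilinear and linear maps *)

Section ArensAdjoint.
Context {R : realType}.

Definition bounded_bilinear (V W Z : normedModType R[i]) (B : V -> W -> Z) :=
  [/\ forall w, linear (B^~ w), forall v, linear (B v) &
      exists M, forall v w, `|B v w| <= M * `|v| * `|w|].

Record bilin (V W Z : normedModType R[i]) := Bilin {
  bilin_fun :> V -> W -> Z;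
  bilinP : bounded_bilinear bilin_fun }.

Section Adjoint.
Context {V W Z : normedModType R[i]} (B : bilin V W Z).

Lemma bilin_bounded : exists2 M, 0 <= M & forall v w, `|B v w| <= M * `|v| * `|w|.
Proof.
have [_ _ [M BM]] := bilinP B; exists `|M| => // v w.
rewrite -[`|v|]normr_id -[`|w|]normr_id -!normrM ger0_norm ?BM//.
by rewrite (le_trans _ (BM v w)).
Qed.

Lemma bilin_boundedr v : B v \in bounded_linear W Z.
Proof.
have [_ Blin _] := bilinP B; have [M _ BM] := bilin_bounded.
by apply/bounded_linearP; split; [exact: Blin|exists (M * `|v|)].
Qed.

(** Arens's adjoint of a bilinear map; three iterations extend a map on [V x W] with values in [Z]
    to the second duals. *)
Definition bilin_adj_fun (f : dual Z) v : dual W :=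
  Bop (dual_comp_subproof f (bilin_boundedr v)).

Lemma bilin_adj_proof : bounded_bilinear bilin_adj_fun.
Proof.
have [Blin _ _] := bilinP B; have [M M0 BM] := bilin_bounded.
split=> [v k f g|f k u v|]; first exact: bopP.
  by apply: bopP => w; rewrite /= Blin linearP.
exists M => f v; apply: dual_norm_le => [|w /=]; first by rewrite !mulr_ge0.
rewrite (le_trans (ler_dual_norm f _))// -!mulrA mulrCA ler_wpM2l// mulrA.
exact: BM.
Qed.

Definition bilin_adj : bilin (dual Z) V (dual W) := Bilin bilin_adj_proof.

End Adjoint.

Lemma bilinDl (U V W : normedModType R[i]) (B : bilin U V W) u u' v :
  B (u + u') v = B u v + B u' v.
Proof. by have [+ _ _] := bilinP B => /(_ v 1 u u'); rewrite !scale1r. Qed.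

Lemma bilinDr (U V W : normedModType R[i]) (B : bilin U V W) u v v' :
  B u (v + v') = B u v + B u v'.
Proof. by have [_ + _] := bilinP B => /(_ u 1 v v'); rewrite !scale1r. Qed.

Lemma bilin0l (U V W : normedModType R[i]) (B : bilin U V W) v : B 0 v = 0.
Proof. by apply: (addrI (B 0 v)); rewrite -bilinDl !addr0. Qed.

Lemma bilin0r (U V W : normedModType R[i]) (B : bilin U V W) u : B u 0 = 0.
Proof. by apply: (addrI (B u 0)); rewrite -bilinDr !addr0. Qed.

Lemma bilinZl (U V W : normedModType R[i]) (B : bilin U V W) k u v :
  B (k *: u) v = k *: B u v.
Proof.
have [+ _ _] := bilinP B => /(_ v k u 0).
by rewrite addr0 bilin0l addr0.
Qed.

Lemma bilinZr (U V W : normedModType R[i]) (B : bilin U V W) k u v :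
  B u (k *: v) = k *: B u v.
Proof.
have [_ + _] := bilinP B => /(_ u k v 0).
by rewrite addr0 bilin0r addr0.
Qed.

Definition bop_adj_fun (V W : normedModType R[i]) (T : bop V W) (f : dual W) : dual V :=
  Bop (dual_comp_subproof f (bop_funP T)).

Lemma bop_adj_proof (V W : normedModType R[i]) (T : bop V W) :
  bop_adj_fun T \in bounded_linear (dual W) (dual V).
Proof.
apply/bounded_linearP; split=> [k f g|]; first exact: bopP.
exists (opnorm T) => f; apply: dual_norm_le => [|v /=].
  by rewrite mulr_ge0// opnorm_ge0.
rewrite (le_trans (ler_dual_norm f _))// mulrAC [leRHS]mulrC ler_wpM2l//.
exact: ler_opnorm.
Qed.

Definition bop_adj (V W : normedModType R[i]) (T : bop V W) : bop (dual W) (dual V) :=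
  Bop (bop_adj_proof T).

Lemma bidual_eval_proof (V : normedModType R[i]) (v : V) :
  (fun f : dual V => f v) \in bounded_linear (dual V) R[i].
Proof.
apply/bounded_linearP; split=> //; exists `|v| => f.
by rewrite mulrC ler_dual_norm.
Qed.

Definition bidual_eval (V : normedModType R[i]) (v : V) : dual (dual V) := Bop (bidual_eval_proof v).

Lemma ler_norm_bidual_eval (V : normedModType R[i]) (v : V) : `|bidual_eval v| <= `|v|.
Proof.
by apply: dual_norm_le => // f /=; rewrite mulrC ler_dual_norm.
Qed.

Lemma bidual_eval_linear (V : normedModType R[i]) : linear (@bidual_eval V).
Proof. by move=> k u v; apply: bopP => f /=; rewrite linearP. Qed.

End ArensAdjoint.

(** * The second dual of a bimodule as a bimodule over the Arens algebra *)

Definition bidual {R : realType} {A : banachAlgType R[i]} (X : bimodType A) : Type :=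
  dual (dual X).

Section Bidual.
Context {R : realType} {A : banachAlgType R[i]} (X : bimodType A).

(** Only the Banach space structure is inherited from [dual (dual X)]: the actions on [bidual X] are
    by [arens A] instead of [A]. *)
HB.instance Definition _ := CompleteNormedModule.on (bidual X).

Lemma lact_bilinear : bounded_bilinear (@lact _ A X).
Proof.
split; last exact: lact_bounded.
  by move=> x k a b; rewrite lactDl lactZl.
by move=> a k x y; rewrite lactDr lactZr.
Qed.

Lemma ract_bilinear : bounded_bilinear (@ract _ A X).
Proof.
split; last exact: ract_bounded.
  by move=> a k x y; rewrite ractDl ractZl.
by move=> x k a b; rewrite ractDr ractZr.
Qed.

(* <m . G, f> = <m, a |-> <G, f . a>> and <G . m, f> = <G, x |-> <m, a |-> <f, x . a>>>;
   for X = A both are the first Arens product. *)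
Definition bidual_lact : bilin (arens A) (bidual X) (bidual X) :=
  bilin_adj (bilin_adj (bilin_adj (Bilin lact_bilinear))).

Definition bidual_ract : bilin (bidual X) (arens A) (bidual X) :=
  bilin_adj (bilin_adj (bilin_adj (Bilin ract_bilinear))).

(** On both sides the functionals are applied in the same order; peeling them off leaves the
    corresponding law of [X]. The next two laws follow likewise. *)
Lemma bidual_lactA m n G :
  bidual_lact m (bidual_lact n G) = bidual_lact (m ** n) G.
Proof.
apply: bopP => f /=; congr (bop_fun m _).
apply: bopP => a /=; congr (bop_fun n _).
apply: bopP => b /=; congr (bop_fun G _).
by apply: bopP => x /=; rewrite lactA.
Qed.

Lemma bidual_ractA G m n :
  bidual_ract G (m ** n) = bidual_ract (bidual_ract G m) n.
Proof.
apply: bopP => f /=; congr (bop_fun G _).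
apply: bopP => x /=; congr (bop_fun m _).
apply: bopP => a /=; congr (bop_fun n _).
by apply: bopP => b /=; rewrite ractA.
Qed.

Lemma bidual_lractA m G n :
  bidual_lact m (bidual_ract G n) = bidual_ract (bidual_lact m G) n.
Proof.
apply: bopP => f /=; congr (bop_fun m _).
apply: bopP => a /=; congr (bop_fun G _).
apply: bopP => x /=; congr (bop_fun n _).
by apply: bopP => b /=; rewrite lractA.
Qed.

HB.instance Definition _ :=
  @CompleteNormedModule_isBanachBimodule.Build R[i] (arens A) (bidual X)
    bidual_lact bidual_ract
    (bilinDl bidual_lact) (bilinDr bidual_lact)
    (bilinZl bidual_lact) (bilinZr bidual_lact) bidual_lactA
    (bilinDl bidual_ract) (bilinDr bidual_ract)
    (bilinZl bidual_ract) (bilinZr bidual_ract) bidual_ractA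
    bidual_lractA
    (let: And3 _ _ b := bilinP bidual_lact in b)
    (let: And3 _ _ b := bilinP bidual_ract in b).

End Bidual.

(** * Approximate amenability passes from the second dual to the algebra *)

Section ApproximateAmenability.
Context {R : realType}.
Implicit Types A : banachAlgType R[i].

Definition bop_of (V W : normedModType R[i]) (T : V -> W)
  (Tlin : linear T) (Tb : bounded_op T) : bop V W :=
  Bop (introT (bounded_linearP T) (conj Tlin Tb)).

Lemma bop_sumE (V W : normedModType R[i]) (I : finType) (f : I -> bop V W) x :
  (\sum_i f i) x = \sum_i f i x.
Proof. by elim/big_rec2: _ => // i _ g _ <-. Qed.

(** In all three terms [m] is applied outermost and [n] next, so their linearity reduces the claim
    to the product rule for [D (a ** b)] tested on [f]. *)
Lemma bidual_derivation A (X : bimodType A) (D : bop A X) : derivation D ->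
  derivation (bop_adj (bop_adj D) : arens A -> bidual X).
Proof.
move=> [_ Dmul]; split; first exact: bop_linear.
move=> m n; apply: bopP => f.
pose B1 := bilin_adj (bilin_adj (Bilin (lact_bilinear X))).
pose B2 := bilin_adj (bilin_adj (Bilin (ract_bilinear X))).
transitivity (m (B1 (bop_adj (bop_adj D) n) f) + m (bop_adj D (B2 n f))); last by [].
rewrite -linearD/=; congr (bop_fun m _).
apply: bopP => a.
apply: etrans (linearD (n : bop _ _) (bop_adj D (bilin_adj (Bilin (lact_bilinear X)) f a))
  (bilin_adj (Bilin (ract_bilinear X)) f (D a))); congr (bop_fun n _).
apply: bopP => b /=.
by rewrite Dmul linearD.
Qed.

(** The canonical embedding is a bimodule map. Used over [arens A], it moves D** into a dual
    bimodule, where approximate amenability applies. *)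
Lemma bidual_eval_derivation A (X : bimodType A) (D : A -> X) : derivation D ->
  derivation (fun a => bidual_eval (D a) : dual (dual X)).
Proof.
move=> [Dlin Dmul]; split; first by move=> k a b; rewrite Dlin bidual_eval_linear.
by move=> a b; apply: bopP => f /=; rewrite Dmul linearD.
Qed.

Lemma approx_amenable_bidual A : approx_amenable (arens A) -> approx_amenable A.
Proof.
move=> Aam X D0 D0der D0b; apply/approx_innerP => s e e0.
pose D : bop A (dual X) := bop_of D0der.1 D0b.
pose D2 := bop_adj (bop_adj D).
pose D4 (m : arens A) : dual (dual (bidual (dual X))) := bidual_eval (D2 m : bidual (dual X)).
have D4der : derivation D4 by apply/bidual_eval_derivation/bidual_derivation.
have D4b : bounded_op D4.
  exists (opnorm D2) => m; apply: le_trans (ler_norm_bidual_eval _) _; exact: ler_opnorm.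
have /approx_innerP D4inn := Aam _ _ D4der D4b.
pose L (i : 'I_(size s)) (y : dual X) := lact s`_i y - ract y s`_i.
have Lb i : L i \in bounded_linear (dual X) (dual X).
  have [_ _ [M lM]] := lact_bilinear (dual X).
  have [_ _ [N rN]] := ract_bilinear (dual X).
  apply/bounded_linearP; split.
    move=> k x y; rewrite /L lactDr lactZr ractDl ractZl scalerBr opprD.
    by rewrite addrACA.
  exists (M * `|s`_i| + N * `|s`_i|) => x.
  rewrite mulrDl (le_trans (ler_normB _ _))// lerD//; first exact: lM.
  by rewrite mulrAC; exact: rN.
pose t := complex.Re e.
have eE : e = t%:C by apply/ger0_ReE/ltW.
have t0 : 0 < t by rewrite -ltcR -eE.
(* With [k = 0] the norm of [x] is left uncontrolled, as for unbounded nets, and the functionals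
   [phi] must annihilate every family [L i y]. *)
have [||||x xP] := @dual_approximation R _ _ _ (fun i => Bop (Lb i))
    (fun i : 'I_(size s) => D s`_i) 0 1 (t / 2) t.
- by [].
- by [].
- move=> phi phi0 phi1.
  (* The [size s] errors then add up to at most [t / 2]; the successor keeps the quotient meaningful
     for empty [s]. *)
  have n0 : 0 < t / (2 * (size s).+1%:R) by rewrite divr_gt0// mulr_gt0.
  have [|Phi PhiP] := D4inn [seq bidual_eval a : arens A | a <- s] (t / (2 * (size s).+1%:R))%:C.
    by rewrite ltcR.
  pose m i : arens A := bidual_eval s`_i.
  pose psi i : dual (bidual (dual X)) := bidual_eval (phi i).
  pose r i : dual (dual (bidual (dual X))) := D4 (m i) - (lact (m i) Phi - ract Phi (m i)).
  have rE i : phi i (D s`_i) = r i (psi i) + Phi (ract (psi i) (m i) - lact (m i) (psi i)).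
    by rewrite linearB; exact/esym/subrK.
  (* This is the canonical image of the sum of the [chi i], and [chi i] sends [y] to
     [phi i (L i y)]; hence [Phi] contributes nothing. *)
  have psi0 : \sum_(i < size s) (ract (psi i) (m i) - lact (m i) (psi i)) = 0.
    pose chi i : dual (dual X) := ract (phi i) s`_i - lact s`_i (phi i).
    have chi0 : \sum_(i < size s) chi i = 0.
      apply: bopP => y; rewrite bop_sumE; apply/eqP; rewrite -normr_le0.
      rewrite -[leRHS](mul0r `|y|); apply: le_trans (phi0 y).
      by under [X in _ <= `|X|]eq_bigr do rewrite linearB.
    apply: bopP => G; rewrite bop_sumE; transitivity (\sum_(i < size s) G (chi i)).
      apply: eq_bigr => i _; apply: etrans (esym (linearB (G : bop _ _) _ _)).
      by congr (_ - _); congr (bop_fun G _); apply: bopP.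
    by rewrite -(linear_sum (G : bop _ _)) chi0 linear0.
  rewrite (eq_bigr _ (fun i _ => rE i)) big_split/= -linear_sum psi0 linear0 addr0.
  apply: (le_trans (ler_norm_sum _ _ _)).
  apply: (@le_trans _ _ (\sum_(i < size s) (t / (2 * (size s).+1%:R))%:C)).
    apply: ler_sum => i _; apply: (le_trans (ler_dual_norm (r i) (psi i))).
    rewrite -[leRHS]mulr1 ler_pM//.
      by apply/ltW/PhiP/map_f/mem_nth.
    by apply: (le_trans (ler_norm_bidual_eval _)); exact: phi1.
  rewrite -rmorph_sum lecR sumr_const card_ord -[leLHS]mulr_natr.
  rewrite invfM mulrA -[leLHS]mulrA ler_piMr//; first by rewrite ltW// divr_gt0.
  by rewrite mulrC ltW// ltr_pdivrMr// mul1r ltr_nat.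
- by lra.
exists x => a /(nthP 0)[i si <-]; rewrite eE.
apply: le_lt_trans xP; rewrite mul0r add0r mul1r.
rewrite (bigD1 (Ordinal si))//= lerDl.
by apply: sumr_ge0 => j _; exact: normr_ge0.
Qed.
End ApproximateAmenability.

(** * Goldstine's theorem and weakly compact operators *)

Section Gantmacher.
Context {R : realType}.

(** Duality with scalar targets: the [phi i] are coefficients of a combination [f] of norm at most
    1, and [m f] is at most the norm of [m]. The weights 1 and [e^-1] with total below 1 bound both
    [x] and the errors. *)
Lemma goldstine (V : normedModType R[i]) (m : dual (dual V)) (s : seq (dual V))
    (e : R) : `|m| < 1 -> 0 < e ->
  exists2 x : V, `|x| <= 1 & forall f, f \in s -> `|m f - f x| < e%:C.
Proof.
move=> m1 e0.
have [||phi phi1 _||x xP] := @dual_approximation R V R[i] _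
    (fun i : 'I_(size s) => s`_i : bop V R[i]) (fun i => m s`_i) 1 e^-1 (rnorm m) 1.
- by [].
- by rewrite invr_ge0 ltW.
- have phiE i w : phi i w = w * phi i 1.
    by rewrite -[w in LHS]mulr1; exact: (linearZ_LR (phi i : bop _ _)).
  pose f : dual V := \sum_(i < size s) phi i 1 *: s`_i.
  have f1 : `|f| <= 1.
    apply: dual_norm_le => // x; apply: le_trans (phi1 x).
    rewrite /f bop_sumE le_eqVlt; apply/orP; left; apply/eqP; congr `|_|.
    by apply: eq_bigr => i _; rewrite [RHS]phiE mulrC.
  have -> : \sum_i phi i (m s`_i) = m f.
    rewrite /f (linear_sum (m : bop _ _)); apply: eq_bigr => i _.
    by rewrite [LHS]phiE mulrC; exact/esym/(linearZ_LR (m : bop _ _)).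
  by rewrite rnormE (le_trans (ler_dual_norm m f))// ler_piMr.
- by rewrite -ltcR rnormE.
have S0 : 0 <= \sum_(i < size s) `|m s`_i - s`_i x| by apply: sumr_ge0.
rewrite mul1r in xP.
exists x => [|f /(nthP 0)[i si <-]].
  apply: le_trans (ltW xP); rewrite lerDl mulr_ge0// lecR invr_ge0 ltW//.
have : e%:C^-1 * (\sum_(i < size s) `|m s`_i - s`_i x|) < 1.
  by rewrite -fmorphV; apply: le_lt_trans xP; rewrite lerDr.
rewrite mulrC ltr_pdivrMr; last by rewrite ltcR.
rewrite mul1r => Se; apply: le_lt_trans Se.
rewrite (bigD1 (Ordinal si))//= lerDl.
by apply: sumr_ge0.
Qed.

Lemma weak_nbhs (V : normedModType R[i]) (f : dual V) (h : weak_space V) (e : R[i]) :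
  0 < e -> nbhs h [set w | `|f h - f w| < e].
Proof.
move=> e0.
have /cvg_sup/(_ f) hf : nbhs h --> h by [].
have := @initial_continuous _ _ (f : V -> R[i]) h.
move/cvgrPdist_lt => /(_ _ e0); exact: hf.
Qed.

(** One half of Gantmacher's theorem: T** maps into the canonical image of [W]. By Goldstine the
    sets [B] of approximating images of the unit ball form a filter base, and a weak cluster point
    represents T** at the rescaled [m]. *)
Lemma weakly_compact_bidual (V W : normedModType R[i]) (T : bop V W) :
  weakly_compact T -> forall m : dual (dual V),
  exists h : W, forall p : dual W, m (bop_adj T p) = p h.
Proof.
move=> [U TU [Uc _]] m.
pose r := `|m| + 1; have r0 : 0 < r by rewrite ltr_wpDl.
pose m0 : dual (dual V) := r^-1 *: m.
have m01 : `|m0| < 1.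
  by rewrite normrZ normfV (gtr0_norm r0) mulrC ltr_pdivrMr// mul1r ltrDl.
pose pos (e : R) : Prop := 0 < e; pose I := (seq (dual W) * {e | pos e})%type.
pose B (i : I) : set (weak_space W) := [set w | exists2 x : V, `|x| <= 1 &
  w = T x /\ forall p, p \in i.1 -> `|m0 (bop_adj T p) - p w| < (sval i.2)%:C].
have FF : ProperFilter (filter_from [set: I] B).
  apply: filter_from_proper; last first.
    move=> [s [e e0]] _.
    have [x x1 xP] := goldstine [seq bop_adj T p | p <- s] m01 e0.
    by exists (T x), x => //; split=> // p ps; exact/xP/map_f.
  apply: filter_from_filter; first by exists ([::], exist pos 1 ltr01).
  move=> [s [e e0]] [t [d d0]] _ _.
  have ed0 : 0 < Num.min e d by rewrite lt_min e0.
  exists (s ++ t, exist pos _ ed0) => // w [x x1 [-> xP]].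
  by split; exists x => //; split => // p pst; (apply: lt_le_trans (xP p _) _;
    [rewrite mem_cat pst ?orbT|rewrite lecR ge_min lexx ?orbT]).
have FU : filter_from [set: I] B U.
  exists ([::], exist pos 1 ltr01) => // w [x x1 [-> _]]; apply: TU; exists x => //.
have [h [_ hcl]] := Uc _ FF FU.
exists (r *: h) => p.
suff ph : p h = m0 (bop_adj T p).
  have rn0 : r != 0 by rewrite gt_eqF.
  apply: etrans (esym (linearZ_LR (p : bop _ _) r (h : W))).
  apply: etrans (congr1 ( *:%R r) (esym ph)).
  exact: (esym (scalerKV rn0 (m (bop_adj T p)))).
apply/eqP; rewrite -subr_eq0 -normr_le0; apply/ler_addgt0Pr => e e0.
have [c c0 ec] : exists2 c : R, 0 < c & e = (c + c)%:C.
  exists (complex.Re e / 2); last by rewrite -splitr -ger0_ReE// ltW.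
  by rewrite divr_gt0// -ltcR -ger0_ReE// ltW.
have Bc : filter_from [set: I] B (B ([:: p], exist pos c c0)).
  by exists ([:: p], exist pos c c0).
have hc : nbhs h [set w | `|p h - p w| < c%:C] by apply: weak_nbhs; rewrite ltcR.
have [w [[x x1 [_ /(_ p (mem_head _ _)) mw]] hw]] := hcl _ _ Bc hc.
rewrite add0r ec rmorphD -(subrKA (p w)) (le_trans (ler_normD _ _))//.
by rewrite lerD//; [exact: ltW hw|rewrite distrC; exact: ltW mw].
Qed.
End Gantmacher.

(** * Approximate weak amenability passes from the second dual to the algebra *)

Section WeakAmenability.
Context {R : realType} {A : banachAlgType R[i]}.
Implicit Types (D : bop A (dual A)) (m n p : arens A).

Lemma lact_bounded_linear (g : dual (self_bimod A)) :
  (fun a => lact a g : dual A) \in bounded_linear A (dual A).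
Proof.
have [Blin _ [M BM]] := lact_bilinear (dual (self_bimod A)).
apply/bounded_linearP; split; first exact: Blin.
by exists (M * `|g|) => a; rewrite mulrAC; exact: BM.
Qed.

(* (m . D** n)(p) = D** n (p ** m) need not be weak-* continuous in m.
   Gantmacher's theorem for D puts D** n in the canonical image of A*, say
   D** n = g, and for a |-> a . g it then exchanges the two iterated limits. *)
Lemma bidual_weak_derivation D :
  derivation (D : A -> dual (self_bimod A)) ->
  (forall T : bop A (dual A), weakly_compact T) ->
  derivation (bop_adj (bop_adj D) : arens A -> dual (self_bimod (arens A))).
Proof.
move=> [_ Dmul] wc; split; first exact: bop_linear.
move=> m n; apply: bopP => p.
have [g gP] := weakly_compact_bidual (wc D) n.
pose T : bop A (dual A) := Bop (lact_bounded_linear g).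
have [h hP] := weakly_compact_bidual (wc T) m.
have hE : h = arens_mf m g.
  apply: bopP => c; transitivity (m (bop_adj T (bidual_eval c))); first by rewrite hP.
  by congr (bop_fun m _); apply: bopP.
(* The product rule for [D (a ** b)] under [p] and then [n]; replacing D** n by [g] turns the first
   term into [p (a . g)]. *)
have split_mn : arens_mf n (bop_adj D p) = bop_adj T p + bop_adj D (n ** p).
  apply: bopP => a.
  transitivity (n (bop_adj D (p ** bidual_eval a : arens A)) + n (arens_mf p (D a))).
    apply: etrans (linearD (n : bop _ _) _ _); congr (bop_fun n _).
    apply: bopP => b; rewrite /= Dmul.
    apply: etrans (linearD (p : bop _ _) _ _) _.
    by congr (bop_fun p _ + bop_fun p _); apply: bopP.
  by rewrite gP; congr (_ + _); congr (bop_fun p _); apply: bopP.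
transitivity (m (bop_adj T p) + m (bop_adj D (n ** p))).
  by rewrite -[RHS](linearD (m : bop _ _)) -split_mn.
(* The representative of T** m is [m [] g], and [p] takes on it the value of [p ** m] at [g], which
   is that of D** n at [p ** m]. *)
congr (_ + _); rewrite hP hE.
exact: (esym (gP (p ** m))).
Qed.

Lemma approx_weakly_amenable_bidual :
  [set: bop A (dual A)] = wcompact_ops A (dual A) ->
  approx_weakly_amenable (arens A) -> approx_weakly_amenable A.
Proof.
move=> wc Aam D0 D0der D0b; apply/approx_innerP => s e e0.
pose D : bop A (dual A) := @bop_of _ _ (dual A) D0 D0der.1 D0b.
have wcT (T : bop A (dual A)) : weakly_compact T.
  by have : [set: bop A (dual A)] T by []; rewrite wc.
pose D2 : arens A -> dual (self_bimod (arens A)) := bop_adj (bop_adj D).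
have D2der : derivation D2 by apply: bidual_weak_derivation.
have D2b : bounded_op D2 by exact: (bop_bounded (bop_adj (bop_adj D))).
have /approx_innerP/(_ [seq bidual_eval a : arens A | a <- s] (e / 2)) := Aam _ D2der D2b.
case=> [|Lam LamP]; first by rewrite divr_gt0.
have lamP : (fun a => Lam (bidual_eval a)) \in bounded_linear A R[i].
  apply: dual_comp_subproof.
  apply/bounded_linearP; split; first exact: bidual_eval_linear.
  by exists 1 => a; rewrite mul1r ler_norm_bidual_eval.
pose lam : dual (self_bimod A) := Bop lamP.
exists lam => a sa.
(* Pointwise estimates bound the dual norm only non-strictly, hence the tolerance [e / 2]. *)
apply: (@le_lt_trans _ _ (e / 2)); last by rewrite ltr_pdivrMr// ltr_pMr// ltr1n.
apply: dual_norm_le => [|b]; first by rewrite ltW// divr_gt0.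
set m : arens A := bidual_eval a.
set p : arens A := bidual_eval b.
(* The Arens product extends that of [A], so restriction to the canonical image respects both
   actions. *)
have -> : (D0 a - (lact a lam - ract lam a)) b =
    (D2 m - (lact m Lam - ract Lam m)) p.
  congr (_ - (_ - _)) => /=; congr (bop_fun Lam _); apply: bopP => f //.
apply: (le_trans (ler_dual_norm _ _)).
rewrite ler_pM//; last exact: ler_norm_bidual_eval.
by apply/ltW/LamP/map_f.
Qed.

End WeakAmenability.

Theorem theorem2p4 (R : realType) (A : banachAlgType R[i]) :
  (approx_amenable (arens A) -> approx_amenable A) /\
  ([set: bop A (dual A)] = wcompact_ops A (dual A) ->
   approx_weakly_amenable (arens A) -> approx_weakly_amenable A).
Proof.
split; first exact: approx_amenable_bidual.
exact: approx_weakly_amenable_bidual.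
Qed.
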